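(* For every LLA expression $\Phi[t_1,\ldots,t_n]$ and every $(\lambda_1,\ldots,\lambda_n)\in\mathbb{R}^n$, \[ \lim_{\varepsilon\to0^+}\frac{\Phi(\varepsilon\lambda_1,\ldots,\varepsilon\lambda_n)}{\varepsilon}=\Phi_0(\lambda_1,\ldots,\lambda_n). \] Moreover, the limit is uniform on compact subsets of $\mathbb{R}^n$.
   Context: A lattice-linear-algebraic (LLA) expression $\Phi[t_1,\ldots,t_n]$ in formal variables $t_1,\ldots,t_n$ is a formal expression built inductively from the variables and the constant $0$ using finitely many times the unary operations of multiplication by a real scalar $\lambda$ ($\lambda\in\mathbb{R}$) and the binary operations $+$, $\vee$ (supremum) and $\cdot$ (product). There is no constant $1$. For $a_1,\ldots,a_n$ in a vector lattice algebra $A$, $\Phi(a_1,\ldots,a_n)\in A$ is the element obtained by substituting $a_i$ for $t_i$ and interpreting the operations in $A$; in particular $\Phi$ defines a function $\mathbb{R}^n\to\mathbb{R}$ using the usual operations and order of $\mathbb{R}$. $\Phi_0[t_1,\ldots,t_n]$ denotes the expression (not involving the product) obtained from $\Phi$ by repeating its inductive construction, except that every time the product operation is performed the resulting expression is replaced by $0$: so $\Phi_0=\Phi$ if $\Phi$ is a variable or $0$, $(\lambda\Psi)_0=\lambda\Psi_0$, $(\Psi+\Upsilon)_0=\Psi_0+\Upsilon_0$, $(\Psi\vee\Upsilon)_0=\Psi_0\vee\Upsilon_0$, $(\Psi\cdot\Upsilon)_0=0$. *)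

(* Defs.v *)
From HB Require Import structures.
From mathcomp Require Import all_boot all_order all_algebra.
From mathcomp Require Import all_classical all_reals all_analysis.

Set Implicit Arguments.
Unset Strict Implicit.
Unset Printing Implicit Defensive.

Import Order.TTheory GRing.Theory Num.Theory.
Import numFieldNormedType.Exports.

Local Open Scope ring_scope.

Inductive lla (R : realType) (n : nat) : Type :=
| LVar of 'I_n
| LZero
| LScale of R & lla R n
| LAdd of lla R n & lla R n
| LSup of lla R n & lla R n
| LMul of lla R n & lla R n.

Arguments LVar {R n} i.
Arguments LZero {R n}.

(* Interpretation in the vector lattice algebra R itself, where the supremum
   of two elements is their maximum; the point v lists the values substituted
   for the variables. *)
Fixpoint lla_eval (R : realType) (n : nat) (Phi : lla R n) (v : 'rV[R]_n) : R :=
  match Phi with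
  | LVar i => v ord0 i
  | LZero => 0
  | LScale c Psi => c * lla_eval Psi v
  | LAdd Psi Ups => lla_eval Psi v + lla_eval Ups v
  | LSup Psi Ups => Num.max (lla_eval Psi v) (lla_eval Ups v)
  | LMul Psi Ups => lla_eval Psi v * lla_eval Ups v
  end.

Fixpoint lla0 (R : realType) (n : nat) (Phi : lla R n) : lla R n :=
  match Phi with
  | LVar i => LVar i
  | LZero => LZero
  | LScale c Psi => LScale c (lla0 Psi)
  | LAdd Psi Ups => LAdd (lla0 Psi) (lla0 Ups)
  | LSup Psi Ups => LSup (lla0 Psi) (lla0 Ups)
  | LMul _ _ => LZero
  end.

(* Main.v *)
Require Import Defs.
From HB Require Import structures.
From mathcomp Require Import all_boot all_order all_algebra.
From mathcomp Require Import all_classical all_reals all_analysis.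
From mathcomp Require Import lra.

Set Implicit Arguments.
Unset Strict Implicit.
Unset Printing Implicit Defensive.

Import Order.TTheory GRing.Theory Num.Theory.
Import numFieldNormedType.Exports.

Local Open Scope classical_set_scope.
Local Open Scope ring_scope.

(** Variables, scalar multiples, sums and suprema commute with dilation by a
    positive [eps], so dividing by [eps] leaves them unchanged; a product of two
    quantities of size [O(eps)] is [O(eps ^+ 2)], so that it disappears in the
    limit of the quotient, exactly as it is erased in [lla0 Phi].

    The lemma [lla_quotient_estimate] makes this quantitative: on every ball of
    ['rV_n] and for [0 < eps <= 1], the quotient [lla_eval Phi (eps *: l) / eps]
    is bounded, and differs from [lla_eval (lla0 Phi) l] by at most a constant
    times [eps]. A compact set lies in a ball, so the estimate gives uniform
    convergence on compact sets; the pointwise limit is uniform convergence on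
    a singleton. *)

Lemma ler_dist_max (R : realDomainType) (a b c d e : R) :
  `|a - c| <= e -> `|b - d| <= e -> `|Num.max a b - Num.max c d| <= e.
Proof.
rewrite !ler_norml => /andP[? ?] /andP[? ?].
by case: (lerP a b) => ?; case: (lerP c d) => ?; apply/andP; split; lra.
Qed.

Lemma ler_norm_coord (R : realType) (n : nat) (l : 'rV[R]_n) (i : 'I_n) :
  `|l ord0 i| <= `|l|.
Proof.
rewrite /Num.Def.normr /= mx_normrE.
exact: (le_bigmax_cond 0 (fun ij : 'I_1 * 'I_n => `|l ij.1 ij.2|)
  (j := (ord0, i))).
Qed.

(** The bound on the quotient and the bound on the error are proved together
    because the error made by erasing a product is
    [eps * (Psi (eps l) / eps) * (Ups (eps l) / eps)], which is [O(eps)] as soon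
    as both quotients are bounded. One constant for both bounds suffices, as it
    may always be enlarged. *)
Lemma lla_quotient_estimate (R : realType) (n : nat) (Phi : lla R n) (M : R) :
  exists2 C : R, 0 <= C & forall (eps : R) (l : 'rV[R]_n),
    0 < eps <= 1 -> `|l| <= M ->
    `|lla_eval Phi (eps *: l) / eps| <= C /\
    `|lla_eval Phi (eps *: l) / eps - lla_eval (lla0 Phi) l| <= C * eps.
Proof.
elim: Phi => [i||c Psi [C C0 IH]|Psi [C C0 IH] Ups [D D0 IHU]
  |Psi [C C0 IH] Ups [D D0 IHU]|Psi [C C0 IH] Ups [D D0 IHU]] /=.
- exists `|M| => // eps l /andP[e0 e1] lM.
  rewrite mxE mulrAC divff ?gt_eqF// mul1r subrr normr0; split.
    exact: le_trans (ler_norm_coord l i) (le_trans lM (ler_norm M)).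
  by rewrite mulr_ge0// ltW.
- by exists 0 => // eps l _ _; rewrite !mul0r subr0 normr0.
- exists (`|c| * C) => [|eps l he lM]; first exact: mulr_ge0.
  have [bnd err] := IH _ _ he lM.
  by rewrite -!mulrA -mulrBr !normrM; split; apply: ler_wpM2l => //;
    rewrite -normrM.
- exists (C + D) => [|eps l he lM]; first exact: addr_ge0.
  have [bnd err] := IH _ _ he lM; have [bndU errU] := IHU _ _ he lM.
  rewrite !mulrDl opprD addrACA; split;
    by apply: le_trans (ler_normD _ _) _; apply: lerD.
- exists (C + D) => [|eps l he lM]; first exact: addr_ge0.
  have [bnd err] := IH _ _ he lM; have [bndU errU] := IHU _ _ he lM.
  have e0 : 0 <= eps by case/andP: he => /ltW.
  have [Ce De] : C * eps <= (C + D) * eps /\ D * eps <= (C + D) * eps.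
    by split; apply: ler_wpM2r => //; lra.
  rewrite maxr_pMl ?invr_ge0//; split; last first.
    by apply: ler_dist_max; [exact: le_trans err Ce|exact: le_trans errU De].
  (* The norm is the distance to 0 = max 0 0. *)
  rewrite -[X in `|X|]subr0 -[X in _ - X](maxxx (0 : R)).
  by apply: ler_dist_max; rewrite subr0; lra.
- exists (C * D) => [|eps l he lM]; first exact: mulr_ge0.
  have [bnd _] := IH _ _ he lM; have [bndU _] := IHU _ _ he lM.
  have /andP[e0 e1] := he.
  set p := lla_eval Psi _ in bnd *; set q := lla_eval Ups _ in bndU *.
  have err : `|p * q / eps| <= C * D * eps.
    have -> : p * q / eps = p / eps * (q / eps) * eps.
      by rewrite -[RHS]mulrA divfK ?gt_eqF// mulrAC.
    rewrite 2!normrM (gtr0_norm e0).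
    by apply: ler_wpM2r; [exact: ltW|apply: ler_pM].
  rewrite subr0; split => //; apply: le_trans err _.
  by rewrite ler_piMr// mulr_ge0.
Qed.

Lemma lla_quotient_cvg_uniform (R : realType) (n : nat) (Phi : lla R n)
    (K : set 'rV[R]_n) : compact K ->
  {uniform K, (fun (eps : R) (l : 'rV[R]_n) => lla_eval Phi (eps *: l) / eps)
    @ 0^'+ --> lla_eval (lla0 Phi)}.
Proof.
move=> /compact_bounded/pinfty_ex_gt0[M _ KM].
have [C C0 est] := lla_quotient_estimate Phi M.
move=> P /uniform_nbhs[E [+ subP]].
rewrite -entourage_ballE => -[r /= r0 ballE].
have C1 : 0 < C + 1 by lra.
near=> eps; apply: subP => l /KM lM; apply: ballE => /=.
have e0 : 0 < eps by near: eps; exact: nbhs_right_gt.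
have e1 : eps <= 1 by near: eps; exact: nbhs_right_le.
have er : eps < r / (C + 1) by near: eps; apply/nbhs_right_lt/divr_gt0.
have [|_ err] := est eps l _ lM; first by rewrite e0.
rewrite /ball/= distrC; apply: le_lt_trans err _.
move: er; rewrite ltr_pdivlMr//; lra.
Unshelve. all: by end_near. Qed.

Theorem lemma2p6 (R : realType) (n : nat) (Phi : lla R n) :
  (forall l : 'rV[R]_n,
     lla_eval Phi (eps *: l) / eps @[eps --> 0^'+] --> lla_eval (lla0 Phi) l) /\
  (forall K : set 'rV[R]_n, compact K ->
     {uniform K, (fun (eps : R) (l : 'rV[R]_n) => lla_eval Phi (eps *: l) / eps) @ 0^'+
        --> lla_eval (lla0 Phi)}).
Proof.
split=> [l|K]; last exact: lla_quotient_cvg_uniform.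
have := lla_quotient_cvg_uniform (Phi := Phi) (@compact_set1 _ l).
by rewrite uniform_set1.
Qed.
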